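(* Let $\mathfrak{X}$ be a nonempty set, $\mathfrak{M}$ a semiring with identity of subsets of $\mathfrak{X}$, and $\{\mu(A),\ A\in\mathfrak{M}\}$ a noise on a probability space $(\Omega,\Theta,\mathbf{P})$ such that the function $m(A\times B):=\mathbf{E}\mu(A)\mu(B)$, $A,B\in\mathfrak{M}$, is a finite $\sigma$-additive signed measure on $\mathfrak{M}^2=\mathfrak{M}\times\mathfrak{M}$. Let $f\in(S,\|\cdot\|)$. Then there exists a sequence of step functions $$f_n(x):=\sum_{k\le n}c_k I(x\in A_k),$$ where $c_k\in\mathbb{R}$, $A_k\in\mathfrak{M}$ (the coefficients and sets may depend on $n$), converging to $f$ in $(S,\|\cdot\|)$ as $n\to\infty$. Moreover, the sequence $$\eta(f_n):=\sum_{k\le n}c_k\,\mu(A_k)$$ converges in mean square (i.e. in $L_2(\Omega,\mathbf{P})$) to a limit random variable $\eta(f)$, which does not depend on the choice of the sequence of step functions $\{f_n\}$ converging to $f$ in $(S,\|\cdot\|)$.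
   Context: A semiring with identity $\mathfrak{M}$ of subsets of $\mathfrak{X}$ is a class of subsets with $\mathfrak{X}\in\mathfrak{M}$ such that for all $A,B\in\mathfrak{M}$ one has $A\cap B\in\mathfrak{M}$ and $A\setminus B$ is a finite disjoint union of elements of $\mathfrak{M}$. A noise (elementary stochastic measure) is a random process $\{\mu(A),\ A\in\mathfrak{M}\}$ with $\mu(A)\in L_2(\Omega,\mathbf{P})$ for all $A\in\mathfrak{M}$ and $\mu(A_1\cup A_2)=\mu(A_1)+\mu(A_2)$ a.s. whenever $A_1,A_2\in\mathfrak{M}$, $A_1\cap A_2=\emptyset$ and $A_1\cup A_2\in\mathfrak{M}$. (No orthogonality of $\mu$ is assumed.) The signed measure $m$ (the covariance measure) extends uniquely to a finite signed measure on $\sigma(\mathfrak{M}^2)$, also denoted $m$; $m=m^+-m^-$ is its Hahn–Jordan decomposition and $|m|=m^++m^-$ its total variation measure. $S$ is the space of $\sigma(\mathfrak{M})$-measurable functions $f:\mathfrak{X}\to\mathbb{R}$ for which the Lebesgue integral $\int_{\mathfrak{X}^2}f(t)f(s)\,m(dt\times ds)$ exists and is finite, equivalently $\int_{\mathfrak{X}^2}|f(t)f(s)|\,|m|(dt\times ds)<\infty$. For $f,g\in S$ put $d(f,g):=\int_{\mathfrak{X}^2}f(t)g(s)\,m(dt\times ds)$; one has $d(f,f)\ge 0$, and $\|f\|:=d(f,f)^{1/2}$ is a seminorm (functions with $d(f,f)=0$ may be identified with zero). Convergence of $f_n$ to $f$ in $(S,\|\cdot\|)$ means $\|f_n-f\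|\to0$.
   Formalization: The theorem adds that f(t)I(s∈A) is |m|-integrable for every A∈M, so that d(f,I_A) exists; this does not follow from f∈S, and without it the claim can fail. The extension of m to a finite signed measure on σ(M²) is taken as given. *)

(* Defs.v *)
From HB Require Import structures.
From mathcomp Require Import all_boot all_order all_algebra.
From mathcomp Require Import all_classical all_reals all_analysis.

Set Implicit Arguments.
Unset Strict Implicit.
Unset Printing Implicit Defensive.

Import Order.TTheory GRing.Theory Num.Theory.
Import numFieldNormedType.Exports.

Local Open Scope classical_set_scope.
Local Open Scope ring_scope.

Definition semiring_with_identity (X : Type) (M : set (set X)) : Prop :=
  [/\ M setT, setI_closed M & semi_setD_closed M].

Section noise.
Context {d : measure_display} {Omega : measurableType d} {R : realType}.
Context {X : pointedType}.
Variables (P : probability Omega R) (M : set (set X)).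

(* Only the values of [mu] on [M] are meaningful. *)
Definition noise (mu : set X -> Omega -> R) : Prop :=
  (forall A, M A -> mu A \in Lfun P 2%:E) /\
  (forall A1 A2, M A1 -> M A2 -> A1 `&` A2 = set0 -> M (A1 `|` A2) ->
    {ae P, forall w, mu (A1 `|` A2) w = mu A1 w + mu A2 w}).

Definition rectangles : set (set (X * X)) := [set A `*` B | A in M & B in M].

(* The value m(A x B) on the rectangle A x B. *)
Definition noise_cov (mu : set X -> Omega -> R) (A B : set X) : \bar R :=
  'E_P[(fun w => mu A w * mu B w)%R]%E.

(* Sigma-additivity on the semiring of rectangles. *)
Definition cov_sigma_additive (mu : set X -> Omega -> R) : Prop :=
  forall (A B : set X) (As Bs : nat -> set X),
    M A -> M B -> (forall k, M (As k)) -> (forall k, M (Bs k)) ->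
    trivIset setT (fun k => As k `*` Bs k) ->
    A `*` B = \bigcup_k (As k `*` Bs k) ->
    (\sum_(0 <= k < n) noise_cov mu (As k) (Bs k))%E @[n --> \oo]
      --> noise_cov mu A B.

Definition mean_square_cvg (Y : nat -> Omega -> R) (Z : Omega -> R) : Prop :=
  'E_P[(fun w => (Y n w - Z w) ^+ 2)%R]%E @[n --> \oo] --> 0%E.

End noise.

Section space_S.
Context {R : realType} {X : pointedType} {M : set (set X)}.
Context {m : {charge set (g_sigma_algebraType (rectangles M)) -> \bar R}}.
Context {Pos Neg : set (g_sigma_algebraType (rectangles M))}.

(* The Jordan decomposition m = m^+ - m^- and the variation |m| do not depend on
   the Hahn decomposition [hm] they are computed from. *)
Variable hm : hahn_decomposition m Pos Neg.

(* The Lebesgue integral of f(t) g(s) with respect to m exists and is finite,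
   that is, f(t) g(s) is integrable with respect to |m|. Beware that |m| need
   not be positive definite, so [in_S f] and [in_S g] do not entail
   [pair_integrable f g]. *)
Definition pair_integrable (f g : X -> R) : Prop :=
  (charge_variation hm).-integrable setT (fun z => (f z.1 * g z.2)%:E).

Definition in_S (f : X -> R) : Prop :=
  measurable_fun [set: g_sigma_algebraType M] f /\ pair_integrable f f.

(* Meaningful only when [pair_integrable f g] holds. *)
Definition d_S (f g : X -> R) : R :=
  \int[jordan_pos hm]_z (f z.1 * g z.2) - \int[jordan_neg hm]_z (f z.1 * g z.2).

Definition norm_S (f : X -> R) : R := Num.sqrt (d_S f f).

Definition cvg_S (F : nat -> X -> R) (f : X -> R) : Prop :=
  norm_S (fun x => F n x - f x) @[n --> \oo] --> 0.

End space_S.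

Definition step_fun {R : realType} {X : Type} (K : nat) (c : nat -> R)
    (A : nat -> set X) : X -> R :=
  fun x => \sum_(1 <= k < K.+1) c k * \1_(A k) x.

Definition step_integral {Omega X : Type} {R : realType}
    (mu : set X -> Omega -> R) (K : nat) (c : nat -> R)
    (A : nat -> set X) : Omega -> R :=
  fun w => \sum_(1 <= k < K.+1) c k * mu (A k) w.

(* Main.v *)
(** On step functions, eta is linear and E eta(s)^2 = d(s, s), so everything rests
on the density of step functions. Put phi = 1 + |f|. The covariance measure is
symmetric, hence so is |m|, and phi(t) phi(s) is |m|-integrable. Functions dominated
by a multiple of phi can be approximated by step functions s with both
|(f - s)(t) (f - s)(s)| and |(f - s)(t)| phi(s) of small |m|-integral: first by
simple functions (dominated convergence), then by replacing measurable sets with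
sets of the algebra generated by M (Dynkin's lemma). This shows d(u, u) >= 0 for
every dominated u, as a limit of the values E eta(s)^2 >= 0. By the parallelogram
identity, E (eta(s) - eta(s'))^2 = d(s - s', s - s') is at most
2 d(s - f, s - f) + 2 d(s' - f, s' - f). A rapidly converging sequence of step
functions therefore gives an almost surely convergent sequence of integrals, and
Fatou's lemma bounds E (eta - eta(s))^2 by 2 d(s - f, s - f) for its limit eta and
every step function s. *)

Require Import Defs.
From mathcomp Require Import all_boot all_order all_algebra.
From mathcomp Require Import all_classical all_reals all_analysis.
From mathcomp Require Import ring lra.
From mathcomp Require Import measurable_realfun.

Set Implicit Arguments.
Unset Strict Implicit.
Unset Printing Implicit Defensive.

Import Order.TTheory GRing.Theory Num.Theory.
Import numFieldNormedType.Exports.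

Local Open Scope classical_set_scope.
Local Open Scope ring_scope.

(** * Integration against a charge *)

Section signed_integral.
Context d (T : measurableType d) (R : realType).
Variable nu : {charge set T -> \bar R}.
Variables (P N : set T) (nuPN : hahn_decomposition nu P N).
Implicit Types (g h : T -> R).

Local Notation var := (charge_variation nuPN).

Lemma integrable_le_measure (m1 m2 : {measure set T -> \bar R}) h :
  (forall A, measurable A -> (m1 A <= m2 A)%E) ->
  m2.-integrable setT (EFin \o h) -> m1.-integrable setT (EFin \o h).
Proof.
move=> m12 /integrableP[mh hoo]; apply/integrableP; split => //.
apply: le_lt_trans hoo; apply: ge0_le_measure_integral => //.
by apply: measurableT_comp mh => //; exact: measurable_abse.
Qed.

Lemma integrable_jordan_pos h :
  var.-integrable setT (EFin \o h) ->
  (jordan_pos nuPN).-integrable setT (EFin \o h).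
Proof.
by apply: integrable_le_measure => A mA; rewrite /charge_variation/= leeDl.
Qed.

Lemma integrable_jordan_neg h :
  var.-integrable setT (EFin \o h) ->
  (jordan_neg nuPN).-integrable setT (EFin \o h).
Proof.
by apply: integrable_le_measure => A mA; rewrite /charge_variation/= leeDr.
Qed.

(** The integral against the signed measure [nu], meaningful when [h] is integrable for the
    variation. On a product [f z.1 * g z.2] it unfolds to [d_S]. *)
Definition signed_int h : R :=
  \int[jordan_pos nuPN]_z h z - \int[jordan_neg nuPN]_z h z.

Lemma signed_intD g h :
  var.-integrable setT (EFin \o g) -> var.-integrable setT (EFin \o h) ->
  signed_int (fun z => g z + h z) = signed_int g + signed_int h.
Proof.
move=> ig ih; rewrite /signed_int !RintegralD//; first by rewrite opprD addrACA.
- exact: integrable_jordan_neg.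
- exact: integrable_jordan_neg.
- exact: integrable_jordan_pos.
- exact: integrable_jordan_pos.
Qed.

Lemma signed_intZ c h :
  var.-integrable setT (EFin \o h) ->
  signed_int (fun z => c * h z) = c * signed_int h.
Proof.
move=> ih; rewrite /signed_int !RintegralZl//; first by rewrite mulrBr.
- exact: integrable_jordan_neg.
- exact: integrable_jordan_pos.
Qed.

Lemma signed_int0 : signed_int (fun=> 0) = 0.
Proof. by rewrite /signed_int !Rintegral_cst// !mul0r subrr. Qed.

Lemma signed_int_indic A : measurable A -> signed_int \1_A = fine (nu A).
Proof.
move=> mA; rewrite (jordan_decomp nuPN mA) /cadd /signed_int /Rintegral/=.
rewrite !integral_indic// !setIT cscaleN1 fineD//= ?fineN ?fin_numN//.
all: exact: fin_num_measure.
Qed.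

Lemma Rintegral_charge_variation h : (forall z, 0 <= h z) ->
  var.-integrable setT (EFin \o h) ->
  \int[var]_z h z = \int[jordan_pos nuPN]_z h z + \int[jordan_neg nuPN]_z h z.
Proof.
move=> h0 ih; have /integrableP[mh _] := ih.
rewrite /Rintegral -fineD.
- rewrite -ge0_integral_measure_add//; last by move=> z _; rewrite lee_fin.
  congr fine; apply: eq_measure_integral => A mA _.
  by rewrite [RHS](measure_addE (jordan_pos nuPN) (jordan_neg nuPN)).
- exact: integrable_fin_num (integrable_jordan_pos ih).
- exact: integrable_fin_num (integrable_jordan_neg ih).
Qed.

Lemma le_norm_signed_int h : var.-integrable setT (EFin \o h) ->
  `|signed_int h| <= \int[var]_z `|h z|.
Proof.
move=> ih; rewrite Rintegral_charge_variation//; last exact: integrable_norm.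
rewrite (le_trans (ler_normB _ _))// lerD// le_normr_Rintegral//.
- exact: integrable_jordan_pos.
- exact: integrable_jordan_neg.
Qed.

End signed_integral.

(** * Symmetry of the covariance measure and of its variation *)

Section symmetric_charge.
Context {R : realType} {X : pointedType} {M : set (set X)}.
Local Notation XX := (g_sigma_algebraType (rectangles M)).

Lemma setI_closed_rectangles : setI_closed M -> setI_closed (rectangles M).
Proof.
move=> MI _ _ [A MA [B MB <-]] [C MC [D MD <-]].
exists (A `&` C); first exact: MI.
by exists (B `&` D); [exact: MI|rewrite setXI].
Qed.

Lemma measurable_swap_rectangles : measurable_fun setT (@swap_pair X X : XX -> XX).
Proof.
suff: preimage_set_system [set: XX] (@swap_pair X X) (rectangles M) `<=` @measurable _ XX.
  exact: (@measurability _ _ XX XX).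
move=> _ [_ [A MA [B MB <-]] <-]; rewrite setTI.
apply: sub_sigma_algebra; exists B => //; exists A => //.
by apply/seteqP; split => -[x y] [].
Qed.

Lemma measurable_rectangle A B : M A -> M B -> measurable (A `*` B : set XX).
Proof. by move=> MA MB; apply: sub_sigma_algebra; exists A => //; exists B. Qed.

Variable m : {charge set XX -> \bar R}.
Hypotheses (MT : M setT) (MI : setI_closed M).
Hypothesis msym : forall A B, M A -> M B -> m (A `*` B) = m (B `*` A).

Let mswap (E : set XX) : measurable E -> measurable (swap_pair @^-1` E : set XX).
Proof.
move=> mE; rewrite -[X in measurable X]setTI.
exact: measurable_swap_rectangles.
Qed.

(** The sets on which [m] and its image under the swap agree form a Dynkin system; it contains the
    rectangles by [msym], and these are stable under intersection. *)
Lemma charge_swap (E : set XX) : measurable E -> m (swap_pair @^-1` E) = m E.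
Proof.
move: E; apply: (@dynkin_induction _ XX (rectangles M)) => //.
- exact: setI_closed_rectangles.
- move=> _ [A MA [B MB <-]]; rewrite msym//; congr (m _).
  by apply/seteqP; split => -[x y] [].
- move=> E mE IH; rewrite preimage_setC.
  have chargeC (F : set XX) : measurable F -> (m (~` F) = m setT - m F)%E.
    by move=> mF; rewrite -setTD chargeD ?setTI.
  by rewrite !chargeC ?IH//; exact: mswap.
- move=> F mF tF IH; rewrite preimage_bigcup.
  have tF' : trivIset setT (fun k => swap_pair @^-1` F k : set XX).
    by apply/trivIsetP => i j _ _ ij; rewrite -preimage_setI;
      move/trivIsetP : tF => -> //; rewrite preimage_set0.
  have h1 := charge_semi_sigma_additive (s := m) F mF tF
    (bigcup_measurable (fun k _ => mF k)).
  have h2 := charge_semi_sigma_additive (s := m) _ (fun k => mswap (mF k)) tF'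
    (bigcup_measurable (fun k _ => mswap (mF k))).
  move: h2; under eq_fun do under eq_bigr do rewrite IH.
  by move=> h2; apply: (cvg_unique _ h2 h1).
Qed.

Variables (Pos Neg : set XX) (hm : hahn_decomposition m Pos Neg).

Lemma hahn_decomposition_swap :
  hahn_decomposition m (swap_pair @^-1` Pos) (swap_pair @^-1` Neg).
Proof.
have [[mP P0] [mN N0] PN PN0] := hm.
split.
- split; first exact: mswap.
  move=> E mE EP; rewrite -charge_swap//; apply: P0; first exact: mswap.
  by move=> [x y] /EP.
- split; first exact: mswap.
  move=> E mE EP; rewrite -charge_swap//; apply: N0; first exact: mswap.
  by move=> [x y] /EP.
- by rewrite -preimage_setU PN preimage_setT.
- by rewrite -preimage_setI PN0 preimage_set0.
Qed.

(** The swapped pair is again a Hahn decomposition, and uniqueness lets it replace [Pos] and [Neg]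
    on one side. Symmetry of [m] then identifies the two sides. *)
Lemma charge_variation_swap (E : set XX) : measurable E ->
  charge_variation hm (swap_pair @^-1` E) = charge_variation hm E.
Proof.
move=> mE; have [[mP _] [mN _] _ _] := hm.
rewrite /charge_variation/= !jordan_posE !jordan_negE !cjordan_posE !cjordan_negE.
rewrite /crestr0 !mem_set//; last exact: mswap.
rewrite /crestr.
have swapK (B : set XX) : swap_pair @^-1` (swap_pair @^-1` B) = B by apply/seteqP; split=> -[].
have h := Hahn_decomposition_uniq hm hahn_decomposition_swap mE.
rewrite h.1 h.2; congr (_ + - _)%E.
- rewrite -charge_swap ?preimage_setI ?swapK//.
  by apply: measurableI => //; exact: mswap.
- rewrite -charge_swap ?preimage_setI ?swapK//.
  by apply: measurableI => //; exact: mswap.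
Qed.

End symmetric_charge.

(** * Products of dominated functions *)

Section tensor.
Context {R : realType} {X : pointedType} {M : set (set X)}.
Local Notation T1 := (g_sigma_algebraType M).
Local Notation XX := (g_sigma_algebraType (rectangles M)).
Hypothesis MT : M setT.

Lemma measurable_fst_rectangles : measurable_fun [set: XX] (fst : XX -> T1).
Proof.
suff: preimage_set_system [set: XX] (fst : XX -> T1) M `<=` @measurable _ XX.
  exact: (@measurability _ _ XX T1).
move=> _ [A MA <-]; rewrite setTI.
apply: sub_sigma_algebra; exists A => //; exists setT => //.
by apply/seteqP; split => -[x y] // [].
Qed.

Lemma measurable_snd_rectangles : measurable_fun [set: XX] (snd : XX -> T1).
Proof.
suff: preimage_set_system [set: XX] (snd : XX -> T1) M `<=` @measurable _ XX.
  exact: (@measurability _ _ XX T1).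
move=> _ [A MA <-]; rewrite setTI.
apply: sub_sigma_algebra; exists setT => //; exists A => //.
by apply/seteqP; split => -[x y] // [].
Qed.

Definition tensor (u v : X -> R) : XX -> R := fun z => u z.1 * v z.2.

Lemma measurable_tensor (u v : T1 -> R) :
  measurable_fun setT u -> measurable_fun setT v ->
  measurable_fun setT (tensor u v).
Proof.
move=> mu mv; apply: measurable_funM.
- exact: (measurableT_comp mu measurable_fst_rectangles).
- exact: (measurableT_comp mv measurable_snd_rectangles).
Qed.

Variables (nu : {measure set XX -> \bar R}) (phi : X -> R).
Hypotheses (mphi : measurable_fun [set: T1] phi) (phi1 : forall x, 1 <= phi x).
Hypothesis iphi : nu.-integrable setT (EFin \o tensor phi phi).

(** The working space that replaces [in_S]: it is stable under linear combinations, and any two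
    members have an integrable tensor product. Since [phi] is at least 1 it contains the bounded
    measurable functions. *)
Definition dominated (u : X -> R) :=
  measurable_fun [set: T1] u /\ exists K, forall x, `|u x| <= K * phi x.

Lemma dominatedD u v : dominated u -> dominated v ->
  dominated (fun x => u x + v x).
Proof.
move=> [mu [K uK]] [mv [L vL]]; split; first exact: measurable_funD.
by exists (K + L) => x; rewrite mulrDl (le_trans (ler_normD _ _))// lerD.
Qed.

Lemma dominatedZ c u : dominated u -> dominated (fun x => c * u x).
Proof.
move=> [mu [K uK]]; split; first exact: measurable_funM.
by exists (`|c| * K) => x; rewrite normrM -mulrA ler_wpM2l.
Qed.

Lemma dominatedB u v : dominated u -> dominated v ->
  dominated (fun x => u x - v x).
Proof.
move=> du /(dominatedZ (-1)) dv.
rewrite (_ : (fun x => _) = fun x => u x + (-1) * v x); first exact: dominatedD.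
by apply/funext => x; rewrite mulN1r.
Qed.

Lemma dominated_bounded (u : T1 -> R) C : measurable_fun setT u ->
  (forall x, `|u x| <= C) -> dominated u.
Proof.
move=> mu uC; split => //; exists C => x.
rewrite (le_trans (uC _))// ler_peMr//.
exact: le_trans (uC x).
Qed.

Lemma dominated_indic (A : set T1) : measurable A -> dominated \1_A.
Proof.
move=> mA; apply: (@dominated_bounded _ 1) => // x.
by rewrite indicE; case: (_ \in _); rewrite ?normr1 ?normr0.
Qed.

Lemma dominated_norm u : dominated u -> dominated (fun x => `|u x|).
Proof.
move=> [mu [K uK]]; split; first exact: measurableT_comp.
by exists K => x; rewrite normr_id.
Qed.

Lemma dominated_phi : dominated phi.
Proof.
split => //; exists 1 => x; rewrite mul1r ger0_norm//.
exact: le_trans (phi1 x).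
Qed.

Lemma integrable_tensor u v : dominated u -> dominated v ->
  nu.-integrable setT (EFin \o tensor u v).
Proof.
move=> [mu [K uK]] [mv [L vL]].
have iKL := integrableZl measurableT (K * L) iphi.
apply: le_integrable iKL => //.
  apply/measurable_EFinP; exact: measurable_tensor.
move=> z _ /=; rewrite lee_fin /tensor [leRHS]ger0_norm//.
  by rewrite normrM mulrACA ler_pM.
rewrite mulrACA mulr_ge0//; [exact: le_trans (uK _)|exact: le_trans (vL _)].
Qed.

(** Not a norm but a pairing: it is subadditive in each argument separately, and no Cauchy-Schwarz
    inequality relates it to its diagonal values. *)
Definition tensor_norm (u v : X -> R) : R := \int[nu]_z `|tensor u v z|.

Lemma tensor_norm_ge0 u v : 0 <= tensor_norm u v.
Proof. exact: Rintegral_ge0. Qed.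

Let inorm u v : dominated u -> dominated v ->
  nu.-integrable setT (EFin \o (fun z => `|tensor u v z|)).
Proof. by move=> du dv; apply: integrable_norm; exact: integrable_tensor. Qed.

Lemma le_tensor_norm u v u' v' : dominated u -> dominated v ->
  dominated u' -> dominated v' ->
  (forall x, `|u x| <= `|u' x|) -> (forall x, `|v x| <= `|v' x|) ->
  tensor_norm u v <= tensor_norm u' v'.
Proof.
move=> du dv du' dv' uu' vv'; apply: le_Rintegral => //; try exact: inorm.
by move=> z _; rewrite !normrM ler_pM.
Qed.

Lemma tensor_normDl u u' v : dominated u -> dominated u' -> dominated v ->
  tensor_norm (fun x => u x + u' x) v <= tensor_norm u v + tensor_norm u' v.
Proof.
move=> du du' dv; rewrite /tensor_norm -RintegralD//; try exact: inorm.
apply: le_Rintegral => //.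
- by apply: inorm => //; exact: dominatedD.
- exact: (integrableD measurableT (inorm du dv) (inorm du' dv)).
- by move=> z _; rewrite /tensor mulrDl ler_normD.
Qed.

Lemma tensor_normZl c u v : dominated u -> dominated v ->
  tensor_norm (fun x => c * u x) v = `|c| * tensor_norm u v.
Proof.
move=> du dv; rewrite /tensor_norm -RintegralZl//; last exact: inorm.
by apply: eq_Rintegral => z _; rewrite /tensor -mulrA normrM.
Qed.

Hypothesis nuC : forall E : set XX, measurable E -> nu (swap_pair @^-1` E) = nu E.

Lemma ge0_integral_swap (h : XX -> \bar R) : measurable_fun setT h ->
  (forall z, 0 <= h z)%E -> (\int[nu]_z h (swap_pair z) = \int[nu]_z h z)%E.
Proof.
move=> mh h0.
transitivity (\int[pushforward nu (swap_pair : XX -> XX)]_z h z)%E.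
  by rewrite [RHS](ge0_integral_pushforward measurable_swap_rectangles) ?preimage_setT.
apply: eq_measure_integral => [|mswap A mA _]; first exact: measurable_swap_rectangles.
exact: nuC.
Qed.

Lemma integrable_swap (h : XX -> R) : nu.-integrable setT (EFin \o h) ->
  nu.-integrable setT (EFin \o (h \o swap_pair)).
Proof.
move=> /integrableP[mh hoo]; apply/integrableP; split.
  exact: (measurableT_comp mh measurable_swap_rectangles).
rewrite (@ge0_integral_swap (fun z => `|(h z)%:E|%E))//.
by apply: measurableT_comp mh => //; exact: measurable_abse.
Qed.

Lemma tensor_normC u v : dominated u -> dominated v ->
  tensor_norm u v = tensor_norm v u.
Proof.
move=> [mu _] [mv _]; rewrite /tensor_norm /Rintegral; congr fine.
rewrite -[RHS]ge0_integral_swap//.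
  by apply: eq_integral => -[x y] _ /=; rewrite /tensor/= mulrC.
by apply/measurable_EFinP; apply: measurableT_comp => //; exact: measurable_tensor.
Qed.

Lemma tensor_normDr u v v' : dominated u -> dominated v -> dominated v' ->
  tensor_norm u (fun x => v x + v' x) <= tensor_norm u v + tensor_norm u v'.
Proof.
move=> du dv dv'; rewrite ![tensor_norm u _]tensor_normC//.
  exact: tensor_normDl.
exact: dominatedD.
Qed.

(** Dominated convergence with a multiple of the tensor square of [phi] as majorant. *)
Lemma Rintegral_cvg0 (h : nat -> XX -> R) C :
  (forall n, measurable_fun setT (h n)) ->
  (forall n z, `|h n z| <= C * tensor phi phi z) ->
  (forall z, h n z @[n --> \oo] --> 0) ->
  \int[nu]_z `|h n z| @[n --> \oo] --> 0.
Proof.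
move=> mh hC h0.
have [] := @dominated_convergence _ _ _ nu setT measurableT
  (fun n z => (h n z)%:E) (cst 0%E) (fun z => (C%:E * (tensor phi phi z)%:E)%E).
- by move=> n; exact/measurable_EFinP.
- exact: measurable_cst.
- by apply: aeW => z _; apply/cvg_EFin; [exact: nearW|exact: h0].
- exact: integrableZl.
- by apply: aeW => z n _; rewrite /= lee_fin.
move=> _ + _; under eq_fun do under eq_integral do rewrite sube0.
by move/fine_cvg; apply.
Qed.

End tensor.

(** * Approximation by step functions *)

Section step_functions.
Context {R : realType} {X : Type}.
Implicit Types (l : seq (R * set X)) (M : set (set X)).

(* A list of pairs (coefficient, set) presents a step function. *)
Definition step l : X -> R := fun x => \sum_(p <- l) p.1 * \1_(p.2) x.

Definition supported M l := forall p, p \in l -> M p.2.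

Definition scale_step (a : R) l := [seq (a * p.1, p.2) | p <- l].

(** Presents the pointwise product, because a product of indicators is the indicator of the
    intersection. *)
Definition mul_step l l' := [seq (p.1 * q.1, p.2 `&` q.2) | p <- l, q <- l'].

Lemma step1 A : step [:: (1, A)] = \1_A.
Proof. by apply/funext => x; rewrite /step big_seq1 mul1r. Qed.

Lemma step_cons p l : step (p :: l) = (fun x => p.1 * \1_(p.2) x + step l x).
Proof. by apply/funext => w; rewrite /step big_cons. Qed.

Lemma step_cat l l' x : step (l ++ l') x = step l x + step l' x.
Proof. exact: big_cat. Qed.

Lemma step_scale a l x : step (scale_step a l) x = a * step l x.
Proof.
by rewrite /step big_map mulr_sumr; apply: eq_bigr => p _; rewrite mulrA.
Qed.

Lemma step_mul l l' x : step (mul_step l l') x = step l x * step l' x.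
Proof.
rewrite /step big_allpairs_dep mulr_suml; apply: eq_bigr => p _.
by rewrite mulr_sumr; apply: eq_bigr => q _; rewrite indicI mulrACA.
Qed.

Lemma supported_cons M p l : supported M (p :: l) -> M p.2 /\ supported M l.
Proof.
move=> Mpl; split; first by apply: Mpl; rewrite mem_head.
by move=> q ql; apply: Mpl; rewrite inE ql orbT.
Qed.

Lemma supported_cat M l l' :
  supported M l -> supported M l' -> supported M (l ++ l').
Proof. by move=> Ml Ml' p; rewrite mem_cat => /orP[/Ml|/Ml']. Qed.

Lemma supported_scale M a l : supported M l -> supported M (scale_step a l).
Proof. by move=> Ml _ /mapP[p pl ->]; exact: Ml pl. Qed.

Lemma supported_mul M l l' : setI_closed M ->
  supported M l -> supported M l' -> supported M (mul_step l l').
Proof.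
by move=> MI Ml Ml' _ /allpairsP[[p q]/= [pl ql ->]]; apply: MI; [exact: Ml|exact: Ml'].
Qed.

Lemma supported1 M c A : M A -> supported M [:: (c, A)].
Proof. by move=> MA p; rewrite inE => /eqP ->. Qed.

Lemma norm_step_le l x : `|step l x| <= \sum_(p <- l) `|p.1|.
Proof.
rewrite (le_trans (ler_norm_sum _ _ _))//; apply: ler_sum => p _.
by rewrite normrM indicE; case: (_ \in _); rewrite ?normr1 ?normr0 ?mulr1 ?mulr0.
Qed.

End step_functions.

(** * Approximation of indicators and simple functions *)

Section step_density.
Context {R : realType} {X : pointedType} {M : set (set X)}.
Local Notation T1 := (g_sigma_algebraType M).
Local Notation XX := (g_sigma_algebraType (rectangles M)).
Hypotheses (MT : M setT) (MI : setI_closed M).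

Lemma measurable_step (l : seq (R * set X)) : supported M l ->
  measurable_fun [set: T1] (step l).
Proof.
elim: l => [|p l IH] Ml.
  by rewrite (_ : step _ = cst 0)//; apply/funext => x; rewrite /step big_nil.
rewrite (_ : step _ = fun x => p.1 * \1_(p.2) x + step l x).
  apply: measurable_funD.
    apply: measurable_funM => //; apply: measurable_indic.
    by apply: sub_sigma_algebra; apply: Ml; rewrite mem_head.
  by apply: IH => q ql; apply: Ml; rewrite inE ql orbT.
by apply/funext => x; rewrite /step big_cons.
Qed.

Variables (nu : {measure set XX -> \bar R}) (phi : X -> R).
Hypotheses (mphi : measurable_fun [set: T1] phi) (phi1 : forall x, 1 <= phi x).
Hypothesis iphi : nu.-integrable setT (EFin \o tensor phi phi).

Local Notation dominated := (@dominated R X M phi).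
Local Notation "'N[ u , v ]" := (tensor_norm nu u v) (format "''N[' u ,  v ]").

Lemma dominated_step l : supported M l -> dominated (step l).
Proof.
move=> Ml; apply: (dominated_bounded phi1 (measurable_step Ml)).
exact: norm_step_le.
Qed.

Let dphi : dominated phi. Proof. exact: dominated_phi. Qed.

(* The bound [C] does not depend on [e]: as the pairing is only controlled by
   [phi] on one side, this is what makes the norm of [g - step l] against itself
   small as well. *)
Definition approximable (g : X -> R) := dominated g /\
  exists C, forall e : R, 0 < e -> exists l, [/\ supported M l,
    forall x, `|g x - step l x| <= C & 'N[(fun x => g x - step l x), phi] < e].

Lemma approximableD g h : approximable g -> approximable h ->
  approximable (fun x => g x + h x).
Proof.
move=> [dg [C gC]] [dh [D hD]]; split; first exact: dominatedD.
exists (C + D) => e e0; have e20 : 0 < e / 2 by rewrite divr_gt0.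
have [l [Ml lC le]] := gC _ e20.
have [k [Mk kD ke]] := hD _ e20.
have E x : g x + h x - step (l ++ k) x = (g x - step l x) + (h x - step k x).
  by rewrite step_cat opprD addrACA.
exists (l ++ k); split; first exact: supported_cat.
- by move=> x; rewrite E (le_trans (ler_normD _ _))// lerD.
- rewrite (_ : (fun x => _) = fun x => (g x - step l x) + (h x - step k x)); last exact/funext.
  rewrite (le_lt_trans (tensor_normDl MT iphi _ _ _))//.
  + by apply: dominatedB => //; exact: dominated_step.
  + by apply: dominatedB => //; exact: dominated_step.
  + by rewrite (splitr e) ltrD.
Qed.

Lemma approximableZ c g : approximable g -> approximable (fun x => c * g x).
Proof.
move=> [dg [C gC]]; split; first exact: dominatedZ.
exists (`|c| * C) => e e0.
(* Dividing by [1 + |c|] rather than [|c|] covers the case [c = 0]. *)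
have c0 : 0 < 1 + `|c| by rewrite ltr_pwDl.
have [l [Ml lC le]] := gC _ (divr_gt0 e0 c0).
have E x : c * g x - step (scale_step c l) x = c * (g x - step l x).
  by rewrite step_scale mulrBr.
exists (scale_step c l); split; first exact: supported_scale.
- by move=> x; rewrite E normrM ler_wpM2l.
- rewrite (_ : (fun x => _) = fun x => c * (g x - step l x)); last exact/funext.
  rewrite (tensor_normZl MT iphi)//; last by apply: dominatedB => //; exact: dominated_step.
  rewrite ltr_pdivlMr// in le; apply: le_lt_trans le.
  by rewrite mulrC ler_wpM2l ?tensor_norm_ge0// lerDr.
Qed.

Lemma approximable0 : approximable (fun=> 0).
Proof.
split.
  by apply: (dominated_bounded phi1 (C := 0)) => [|x];
    [exact: measurable_cst|rewrite normr0].
exists 0 => e e0; exists [::]; split => //.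
  by move=> x; rewrite /step big_nil subrr normr0.
rewrite (_ : (fun x => _) = fun x => 0 * phi x); last first.
  by apply/funext => x; rewrite /step big_nil subrr mul0r.
by rewrite (tensor_normZl MT iphi)// normr0 mul0r.
Qed.

Lemma approximable_sum (I : Type) (s : seq I) (g : I -> X -> R) :
  (forall i, approximable (g i)) -> approximable (fun x => \sum_(i <- s) g i x).
Proof.
move=> ag; elim: s => [|i s IH].
  rewrite (_ : (fun x => _) = fun=> 0); first exact: approximable0.
  by apply/funext => x; rewrite big_nil.
rewrite (_ : (fun x => _) = fun x => g i x + \sum_(j <- s) g j x).
  exact: approximableD.
by apply/funext => x; rewrite big_cons.
Qed.

(* The sets whose indicator is a step function form an algebra containing [M]. *)
Definition elementary (A : set X) :=
  exists2 l : seq (R * set X), supported M l & step l = \1_A.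

Lemma elementaryC A : elementary A -> elementary (~` A).
Proof.
move=> [l Ml lA]; exists ([:: (1, setT)] ++ scale_step (-1) l).
  by apply: supported_cat; [exact: supported1|exact: supported_scale].
apply/funext => x; rewrite step_cat step_scale step1 lA indicT indicC/= indicE.
by case: (x \in A); rewrite mulN1r ?subrr ?subr0.
Qed.

Lemma elementaryI A B : elementary A -> elementary B -> elementary (A `&` B).
Proof.
move=> [l Ml lA] [k Mk kB]; exists (mul_step l k); first exact: supported_mul.
by apply/funext => x; rewrite step_mul lA kB indicI.
Qed.

Lemma elementaryU A B : elementary A -> elementary B -> elementary (A `|` B).
Proof.
move=> /elementaryC eA /elementaryC eB; rewrite -[_ `|` _]setCK setCU.
exact/elementaryC/elementaryI.
Qed.

(** [A] is the preimage of 1 under a measurable step function. *)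
Lemma elementary_measurable A : elementary A -> measurable (A : set T1).
Proof.
move=> [l Ml lA].
have := measurable_step Ml; rewrite lA => /(_ measurableT [set 1] (measurable_set1 _)).
rewrite setTI (_ : _ @^-1` _ = A)//; apply/seteqP; split => x /=; rewrite indicE.
  by case: (boolP (x \in A)) => [/set_mem//|_ /eqP]; rewrite eq_sym oner_eq0.
by move=> /mem_set ->.
Qed.

(** Dynkin induction from the sets of [M]. Complements keep the same error. A countable union is
    first replaced by a finite one, with an error that vanishes by dominated convergence, and finite
    unions of good sets are good because elementary sets form an algebra. *)
Lemma approx_elementary (B : set T1) : measurable B -> forall e : R, 0 < e ->
  exists2 A, elementary A & 'N[(fun x => \1_B x - \1_A x), phi] < e.
Proof.
move=> mB.
suff : measurable B /\ forall e : R, 0 < e ->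
  exists2 A, elementary A & 'N[(fun x => \1_B x - \1_A x), phi] < e by case.
have d1 (A : set T1) : measurable A -> dominated \1_A by exact: dominated_indic.
have dB (A C : set T1) : measurable A -> measurable C -> dominated (fun x => \1_A x - \1_C x).
  by move=> mA mC; apply: dominatedB; exact: d1.
have N0 (e : R) (u : X -> R) : (forall x, u x = 0) -> 0 < e -> 'N[u, phi] < e.
  move=> u0 e0; rewrite (_ : u = fun x => 0 * phi x) ?(tensor_normZl MT iphi) ?normr0 ?mul0r//.
  by apply/funext => x; rewrite u0 mul0r.
pose good (B : set T1) := forall e : R, 0 < e ->
  exists2 A, elementary A & 'N[(fun x => \1_B x - \1_A x), phi] < e.
have goodU (B1 B2 : set T1) : measurable B1 -> measurable B2 -> good B1 -> good B2 ->
    good (B1 `|` B2).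
  move=> mB1 mB2 g1 g2 e e0; have e20 : 0 < e / 2 by rewrite divr_gt0.
  have [A1 eA1 BA1] := g1 _ e20.
  have [A2 eA2 BA2] := g2 _ e20.
  have mA1 := elementary_measurable eA1; have mA2 := elementary_measurable eA2.
  exists (A1 `|` A2); first exact: elementaryU.
  (* The symmetric difference of two unions lies in the union of the symmetric differences. *)
  have h : 'N[(fun x => \1_(B1 `|` B2) x - \1_(A1 `|` A2) x), phi] <=
    'N[(fun x => `|\1_B1 x - \1_A1 x| + `|\1_B2 x - \1_A2 x|), phi].
    apply: (le_tensor_norm MT iphi) => //.
    + by apply: dB; exact: measurableU.
    + by apply: dominatedD; apply: dominated_norm; exact: dB.
    + move=> x; rewrite [leRHS]ger0_norm ?addr_ge0// !indicE !in_setU.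
      case: (x \in B1); case: (x \in B2); case: (x \in A1);
        case: (x \in A2) => /=;
        rewrite ?subrr ?subr0 ?sub0r ?normrN ?normr1 ?normr0 ?addr0 ?add0r
          ?lerDl//.
  rewrite (le_lt_trans h)// (le_lt_trans (tensor_normDl MT iphi _ _ _))//;
    try by apply: dominated_norm; exact: dB.
  have nN u : dominated u -> 'N[(fun x => `|u x|), phi] <= 'N[u, phi].
    move=> du; apply: (le_tensor_norm MT iphi) => //; first exact: dominated_norm.
    by move=> x; rewrite normr_id.
  by rewrite (splitr e) ltrD// (le_lt_trans (nN _ _))//; exact: dB.
apply: (@dynkin_induction _ T1 M (fun B => measurable B /\ good B)) => //.
- by split => // e e0; exists setT; [exists [:: (1, setT)]; [exact: supported1|exact: step1]|
    apply: N0 => // x; rewrite subrr].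
- move=> A MA; split; first exact: sub_sigma_algebra.
  by move=> e e0; exists A; [exists [:: (1, A)]; [exact: supported1|exact: step1]|
    apply: N0 => // x; rewrite subrr].
- move=> B1 mB1 [_ gB1]; split; first exact: measurableC.
  move=> e e0; have [A eA BA] := gB1 _ e0; exists (~` A); first exact: elementaryC.
  rewrite (_ : (fun x => _) = fun x => -1 * (\1_B1 x - \1_A x)).
    rewrite (tensor_normZl MT iphi)// ?normrN1 ?mul1r//.
    by apply: dB => //; exact: elementary_measurable.
  apply/funext => x; rewrite !indicC/= !indicE.
  by case: (x \in B1); case: (x \in A) => /=;
    rewrite mulN1r ?subrr ?subr0 ?sub0r ?oppr0 ?opprK.
move=> F mF _ gF.
have mU : measurable (\bigcup_k F k : set T1) :=
  bigcup_measurable (fun k _ => mF k).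
split => // e e0.
pose U n := \big[setU/set0]_(i < n) F i.
have mUn n : measurable (U n) by apply: bigsetU_measurable.
have gU n : good (U n).
  elim: n => [|n IH].
    move=> r r0; exists set0; last by apply: N0 => // x; rewrite /U big_ord0 subrr.
    by rewrite -setCT; apply: elementaryC; exists [:: (1, setT)];
      [exact: supported1|exact: step1].
  rewrite /U big_ord_recr/=; apply: (goodU (U n) (F n)) => //.
  by have [] := gF n.
pose w n x : R := \1_(\bigcup_k F k) x - \1_(U n) x.
have w_cvg : 'N[w n, phi] @[n --> \oo] --> 0.
  apply: (@Rintegral_cvg0 _ _ _ _ _ iphi (fun n => tensor (w n) phi : XX -> R) 1).
  - by move=> n; apply: measurable_tensor => //; have [] := dB _ _ mU (mUn n).
  - move=> n z; rewrite mul1r /tensor normrM [`|phi _|]ger0_norm ?(le_trans ler01)//.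
    rewrite ler_wpM2r ?(le_trans ler01)// (le_trans _ (phi1 _))// /w !indicE.
    by case: (_ \in _); case: (_ \in _); rewrite ?subrr ?subr0 ?sub0r ?normrN ?normr0 ?normr1.
  (* At each point the sequence is eventually zero: either [z.1] lies in no [F k], or it lies in
     [U n] as soon as [n] exceeds some [k] with [z.1] in [F k]. *)
  - move=> z; apply: cvg_near_cst.
    have [[k _ Fkz]|nFz] := pselect ((\bigcup_k F k) z.1); last first.
      apply: nearW => n; rewrite /tensor /w !indicE !memNset ?subrr ?mul0r//.
      by rewrite /U -bigcup_mkord => -[k _ Fkz]; apply: nFz; exists k.
    near=> n; rewrite /tensor /w !indicE !mem_set ?subrr ?mul0r//; last by exists k.
    by rewrite /U -bigcup_mkord; exists k => //=; near: n; exact: nbhs_infty_gt.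
have e20 : 0 < e / 2 by rewrite divr_gt0.
have /cvgr0Pnorm_lt /(_ _ e20) [n _ /(_ n (leqnn n)) /= wn] := w_cvg.
have [A eA UA] := gU n _ e20.
exists A => //.
rewrite (_ : (fun x => _) = fun x => w n x + (\1_(U n) x - \1_A x)); last first.
  by apply/funext => x; rewrite /w addrA subrK.
rewrite (le_lt_trans (tensor_normDl MT iphi _ _ _))//.
- exact: dB.
- by apply: dB => //; exact: elementary_measurable.
- by rewrite (splitr e) ltrD// (le_lt_trans (ler_norm _)).
Unshelve. all: by end_near. Qed.

(** The approximating step functions are themselves indicators, so the error is bounded by 1
    whatever [e] is. *)
Lemma approximable_indic (B : set T1) : measurable B -> approximable \1_B.
Proof.
move=> mB; split; first exact: dominated_indic.
exists 1 => e /(approx_elementary mB)[A [l Ml lA] BA].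
exists l; rewrite lA; split => // x; rewrite !indicE.
by case: (_ \in _); case: (_ \in _); rewrite ?subrr ?subr0 ?sub0r ?normrN ?normr0 ?normr1.
Qed.

Import HBNNSimple.

Lemma approximable_nnsfun (g : {nnsfun T1 >-> R}) : approximable g.
Proof.
rewrite (_ : (g : X -> R) = fun x => \sum_(y <- finmap.enum_fset (fset_set (range g)))
    y * \1_(g @^-1` [set y]) x).
  by apply: approximable_sum => y; apply: approximableZ; apply: approximable_indic.
by apply/funext => x; rewrite fimfunE fsbig_finite.
Qed.

End step_density.

(** * Density of step functions among dominated functions *)

Section density.
Context {R : realType} {X : pointedType} {M : set (set X)}.
Local Notation T1 := (g_sigma_algebraType M).
Local Notation XX := (g_sigma_algebraType (rectangles M)).
Hypotheses (MT : M setT) (MI : setI_closed M).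
Variables (nu : {measure set XX -> \bar R}) (phi : X -> R).
Hypotheses (mphi : measurable_fun [set: T1] phi) (phi1 : forall x, 1 <= phi x).
Hypothesis iphi : nu.-integrable setT (EFin \o tensor phi phi).
Hypothesis nuC : forall E : set XX, measurable E -> nu (swap_pair @^-1` E) = nu E.

Local Notation dominated := (@dominated R X M phi).
Local Notation "'N[ u , v ]" := (tensor_norm nu u v) (format "''N[' u ,  v ]").

Import HBNNSimple.

(** The usual simple approximations increase, so each of them stays below the limit [p]. *)
Lemma nnsfun_dominated_approx (p : T1 -> R) :
  measurable_fun setT p -> (forall x, 0 <= p x) ->
  exists a : nat -> {nnsfun T1 >-> R}, forall x,
    a ^~ x @ \oo --> p x /\ forall n, a n x <= p x.
Proof.
move=> mp p0; have mEp : measurable_fun setT (EFin \o p) by exact/measurable_EFinP.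
exists (nnsfun_approx measurableT mEp) => x.
have cvg_x : (nnsfun_approx measurableT mEp)^~ x @ \oo --> p x.
  have := cvg_nnsfun_approx measurableT mEp (fun y _ => p0 y) (x := x) I.
  by move/fine_cvg.
split => // n; rewrite -(cvg_lim _ cvg_x)//; apply: nondecreasing_cvgn_le.
  by move=> i j ij; exact/lefP/nd_nnsfun_approx.
by apply/cvg_ex; exists (p x).
Qed.

(** Approximate the positive and negative parts from below. At each point one part vanishes together
    with its approximations, so the error never exceeds [|f x|]; this is the majorant for dominated
    convergence. *)
Lemma approximable_approx (f : T1 -> R) : measurable_fun setT f ->
  exists g : nat -> X -> R, (forall n, approximable nu phi (g n)) /\
    forall x, g ^~ x @ \oo --> f x /\ forall n, `|f x - g n x| <= `|f x|.
Proof.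
move=> mf.
have [a ha] : exists a : nat -> {nnsfun T1 >-> R}, forall x,
    a ^~ x @ \oo --> Num.max (f x) 0 /\ forall n, a n x <= Num.max (f x) 0.
  apply: nnsfun_dominated_approx => [|x]; last by rewrite le_max lexx orbT.
  exact: measurable_maxr.
have [b hb] : exists b : nat -> {nnsfun T1 >-> R}, forall x,
    b ^~ x @ \oo --> Num.max (- f x) 0 /\ forall n, b n x <= Num.max (- f x) 0.
  apply: nnsfun_dominated_approx => [|x]; last by rewrite le_max lexx orbT.
  by apply: measurable_maxr => //; exact: measurableT_comp.
exists (fun n x => a n x + (-1) * b n x); split.
  move=> n; apply: approximableD => //; first exact: approximable_nnsfun.
  by apply: approximableZ => //; exact: approximable_nnsfun.
move=> x; have [ax axle] := ha x; have [bx bxle] := hb x; split.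
  rewrite [X in _ --> X](_ : f x = Num.max (f x) 0 + (-1) * Num.max (- f x) 0).
    by apply: cvgD => //; apply: cvgM => //; exact: cvg_cst.
  by have [f0|/ltW f0] := leP 0 (f x); 
    [rewrite max_r ?oppr_le0|rewrite max_l ?oppr_ge0];
    rewrite ?mulr0 ?addr0 ?add0r ?mulN1r ?opprK.
move=> n; have := axle n; have := bxle n.
have a0 : 0 <= a n x by []. have b0 : 0 <= b n x by [].
have [f0|/ltW f0] := leP 0 (f x).
  rewrite max_r ?oppr_le0// => b1 a1.
  by rewrite (ger0_norm f0) ler_norml; apply/andP; split; lra.
rewrite max_l ?oppr_ge0// => b1 a1.
by rewrite (ler0_norm f0) ler_norml; apply/andP; split; lra.
Qed.

(** Split [f - step l] as [u n + v] with [u n = f - g n] and [v = g n - step l]. First [n] is chosen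
    by dominated convergence; this fixes the bound [C] on [v], and only then is [l] chosen. Both the
    cross terms and the square of [v] are controlled by the pairing of [v] with [phi]. *)
Lemma step_density (f : X -> R) : dominated f -> forall e : R, 0 < e ->
  exists l, [/\ supported M l,
    'N[(fun x => f x - step l x), (fun x => f x - step l x)] < e &
    'N[(fun x => f x - step l x), phi] < e].
Proof.
move=> [mf [K fK]] e e0.
have dphi : dominated phi by exact: dominated_phi.
(* The sign of [K] is read off at [point], where [phi] is positive. *)
have K0 : 0 <= K.
  have := le_trans (normr_ge0 _) (fK point).
  by rewrite pmulr_lge0// (lt_le_trans ltr01).
have phi0 x : 0 <= phi x by exact: le_trans (phi1 x).
have [g [ag gf]] := approximable_approx mf.
pose u n x := f x - g n x.
have df : dominated f by split => //; exists K.
have du n : dominated (u n) by apply: dominatedB => //; have [] := ag n.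
have uK n x : `|u n x| <= K * phi x by rewrite (le_trans ((gf x).2 n)).
have u0 x : u n x @[n --> \oo] --> 0.
  by rewrite -(subrr (f x)); apply: cvgB; [exact: cvg_cst|exact: (gf x).1].
have e20 : 0 < e / 2 by rewrite divr_gt0.
have uu_cvg : 'N[u n, u n] @[n --> \oo] --> 0.
  apply: (@Rintegral_cvg0 _ _ _ _ _ iphi (fun n => tensor (u n) (u n) : XX -> R) (K * K)).
  - by move=> n; apply: measurable_tensor => //; have [] := du n.
  - by move=> n z; rewrite normrM /tensor mulrACA ler_pM.
  - by move=> z; rewrite -(mulr0 0); apply: cvgM; exact: u0.
have uphi_cvg : 'N[u n, phi] @[n --> \oo] --> 0.
  apply: (@Rintegral_cvg0 _ _ _ _ _ iphi (fun n => tensor (u n) phi : XX -> R) K).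
  - by move=> n; apply: measurable_tensor => //; have [] := du n.
  - by move=> n z; rewrite normrM /tensor mulrA [`|phi _|]ger0_norm// ler_wpM2r.
  - by move=> z; rewrite -(mul0r (phi z.2)); apply: cvgM; [exact: u0|exact: cvg_cst].
have [n [uun uphin]] : exists n, 'N[u n, u n] < e / 2 /\ 'N[u n, phi] < e / 2.
  have /cvgr0Pnorm_lt /(_ _ e20) [n1 _ h1] := uu_cvg.
  have /cvgr0Pnorm_lt /(_ _ e20) [n2 _ h2] := uphi_cvg.
  exists (maxn n1 n2); split.
    by apply: le_lt_trans (h1 _ _); [exact: ler_norm|exact: leq_maxl].
  by apply: le_lt_trans (h2 _ _); [exact: ler_norm|exact: leq_maxr].
have [dg [C gC]] := ag n.
(* The two cross terms cost [2 * K] and the square of [v] costs [|C|] times the pairing of [v] with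
   [phi]; the summand 1 serves the second estimate and makes the divisor positive. *)
have D0 : 0 < 1 + 2 * K + `|C| by rewrite ltr_pwDl// ltr_wpDr// mulr_ge0.
have [l [Ml lC le]] := gC _ (divr_gt0 e20 D0).
pose v x := g n x - step l x.
have dl : dominated (step l) by exact: dominated_step.
have dv : dominated v by exact: dominatedB.
have duv : dominated (fun x => u n x + v x) by exact: dominatedD.
have E : (fun x => f x - step l x) = fun x => u n x + v x.
  by apply/funext => x; rewrite /u /v addrA subrK.
have vu : 'N[v, u n] <= K * 'N[v, phi].
  rewrite -[K]ger0_norm// !(tensor_normC MT nuC dv)//.
  rewrite -(tensor_normZl MT iphi)//.
  apply: (le_tensor_norm MT iphi) => //; first exact: dominatedZ.
  by move=> x; rewrite normrM (ger0_norm K0) (ger0_norm (phi0 x)).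
have vv : 'N[v, v] <= `|C| * 'N[v, phi].
  rewrite !(tensor_normC MT nuC dv)//.
  rewrite -(tensor_normZl MT iphi)//.
  apply: (le_tensor_norm MT iphi) => //; first exact: dominatedZ.
  move=> x; rewrite (le_trans (lC x))// normrM (ger0_norm (phi0 x)).
  by rewrite (le_trans (ler_norm _))// ler_peMr.
have v0 : 0 <= 'N[v, phi] by exact: tensor_norm_ge0.
rewrite ltr_pdivlMr// in le.
exists l; split => //; rewrite E.
- apply: le_lt_trans (tensor_normDl MT iphi _ _ _) _ => //.
  have := tensor_normDr MT iphi nuC (du n) (du n) dv.
  have := tensor_normDr MT iphi nuC dv (du n) dv.
  rewrite (tensor_normC MT nuC (du n) dv).
  rewrite -/v in le. nra.
- apply: le_lt_trans (tensor_normDl MT iphi _ _ _) _ => //.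
  have : 0 <= (2 * K + `|C|) * 'N[v, phi] by rewrite mulr_ge0// addr_ge0// mulr_ge0.
  rewrite -/v in le. lra.
Qed.

End density.

(** * Mean square limits *)

Section mean_square_completeness.
Context d (T : measurableType d) (R : realType) (P : probability T R).
Implicit Types (Y : nat -> T -> R) (Z W : T -> R).

(** The free parameter [b] is to be matched to the size of the second moment, which makes a rapidly
    decreasing sequence of second moments give summable first moments. *)
Lemma expectation_norm_le (W : T -> R) (b c : R) : measurable_fun setT W ->
  0 < b -> ('E_P[(fun w => W w ^+ 2)%R] <= c%:E)%E ->
  (\int[P]_w `|W w|%R%:E <= (b * c + b^-1)%R%:E)%E.
Proof.
move=> mW b0; rewrite unlock => Wc.
have mW2 : measurable_fun setT (fun w => (W w ^+ 2)%:E).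
  by apply/measurable_EFinP; exact: measurable_funX.
apply: (@le_trans _ _ (\int[P]_w (b%:E * (W w ^+ 2)%:E + (b^-1)%:E))%E).
  apply: ge0_le_integral => //.
  - by apply/measurable_EFinP; exact: measurableT_comp.
  - by apply: emeasurable_funD => //; exact: measurable_funeM.
  (* |x| <= b x^2 + 1/b, by comparing |x| with 1/b *)
  - move=> w _; rewrite -EFinM -EFinD lee_fin -(real_normK (num_real (W w))).
    have [wb|bw] := leP `|W w| b^-1.
      by rewrite (le_trans wb)// lerDr mulr_ge0 ?sqr_ge0// ltW.
    rewrite (@le_trans _ _ (b * `|W w| ^+ 2))//; last by rewrite lerDl invr_ge0 ltW.
    rewrite expr2 mulrA ler_peMl// mulrC -ler_pdivrMr// div1r; exact: ltW.
rewrite ge0_integralD//; last 3 first.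
- by move=> w _; rewrite -EFinM lee_fin mulr_ge0 ?sqr_ge0// ltW.
- exact: measurable_funeM.
- by move=> w _; rewrite lee_fin invr_ge0 ltW.
rewrite ge0_integralZl_EFin//; [|by move=> w _; rewrite lee_fin sqr_ge0|exact: ltW].
rewrite integral_cst//= probability_setT mule1 EFinD EFinM leeD2r//.
by rewrite lee_pmul2l.
Qed.

(** The absolute increments have summable expectations, so their sum is integrable, hence finite
    almost everywhere. There the telescoping series converges absolutely, and [Y] converges. *)
Lemma ae_cvg_fast Y (c : R) : 0 <= c -> (forall n, measurable_fun setT (Y n)) ->
  (forall n, 'E_P[(fun w => (Y n.+1 w - Y n w) ^+ 2)%R] <= (c / 4 ^+ n)%:E)%E ->
  exists2 Z : T -> R, measurable_fun setT Z & {ae P, forall w, Y ^~ w @ \oo --> Z w}.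
Proof.
move=> c0 mY Yc.
pose D n w : R := `|Y n.+1 w - Y n w|.
have mD (n : nat) : measurable_fun setT (fun w => (D n w)%:E).
  by apply/measurable_EFinP; apply: measurableT_comp => //; exact: measurable_funB.
have D0 n w : (0 <= (D n w)%:E)%E by rewrite lee_fin normr_ge0.
have S0 w : (0 <= \sum_(n <oo) (D n w)%:E)%E.
  by apply: nneseries_ge0 => n _ _; exact: D0.
(* Taking [b = 2 ^ n] bounds the expectation by [(c + 1) / 2 ^ n], written here in the form that
   [epsilon_trick0] sums. *)
have iD n : (\int[P]_w (D n w)%:E <= ((2 * (c + 1)) / (2 ^ n.+1)%:R)%:E)%E.
  apply: le_trans (expectation_norm_le (b := 2 ^+ n) _ _ (Yc n)) _ => //.
    exact: measurable_funB.
  rewrite lee_fin natrX (_ : 4 = 2 * 2 :> R); last by ring.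
  rewrite exprMn exprS.
  have p0 : (2 ^+ n : R) != 0 by rewrite expf_neq0.
  by rewrite le_eqVlt; apply/orP; left; apply/eqP; field; rewrite p0.
have iS : P.-integrable setT (fun w => \sum_(n <oo) (D n w)%:E)%E.
  apply/integrableP; split.
    by apply: (ge0_emeasurable_sum (P := xpredT)) => [n w _ _|n _];
      [rewrite lee_fin normr_ge0|exact: mD].
  under eq_integral do rewrite gee0_abs ?S0//.
  rewrite integral_nneseries//; apply: le_lt_trans (ltry (2 * (c + 1))).
  apply: le_trans (epsilon_trick0 xpredT _); last by rewrite mulr_ge0// addr_ge0.
  by apply: lee_nneseries => n *; [exact: integral_ge0|exact: iD].
(* The upper limit is measurable on the whole space and equals the limit wherever there is one. *)
exists (fun w => fine (limn_esup (fun n => (Y n w)%:E))).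
  apply: measurableT_comp => //; apply: measurable_fun_limn_esup => n.
  exact/measurable_EFinP.
have := integrable_ae measurableT iS; apply: filterS => w /(_ I) fin_w.
have nD : cvgn [normed series (telescope (Y ^~ w))].
  apply: nondecreasing_is_cvgn.
    by apply: nondecreasing_series => n _ _; exact: normr_ge0.
  exists (fine (\sum_(n <oo) (D n w)%:E)%E) => _ [n _ <-].
  rewrite -lee_fin fineK// -sumEFin; apply: nneseries_lim_ge => k _ _.
  exact: D0.
have /cvg_ex[l Yl] : cvgn (Y ^~ w).
  rewrite (_ : Y ^~ w = (fun n => Y 0%N w + series (telescope (Y ^~ w)) n)).
    by apply: is_cvgD; [exact: is_cvg_cst|exact: normed_cvg nD].
  by apply/funext => n; rewrite telescopeK/= addrC subrK.
have /cvg_limn_einf_sup[_ ->] : (Y n w)%:E @[n --> \oo] --> l%:E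
  by apply/cvg_EFin; [exact: nearW|exact: Yl].
exact: Yl.
Qed.

(** Off the null set [A] the squares converge to that of [Z - W], so Fatou's lemma applies. Shifting
    the sequence by [N] puts every term under the bound [e]. *)
Lemma fatou_mean_square Y Z W (e : R) N :
  (forall n, measurable_fun setT (Y n)) -> measurable_fun setT Z ->
  measurable_fun setT W -> {ae P, forall w, Y ^~ w @ \oo --> Z w} ->
  (forall n, (N <= n)%N -> 'E_P[(fun w => (Y n w - W w) ^+ 2)%R] <= e%:E)%E ->
  ('E_P[(fun w => (Z w - W w) ^+ 2)%R] <= e%:E)%E.
Proof.
move=> mY mZ mW [A [mA A0 YZ]] Ye.
have mq (V : T -> R) : measurable_fun setT V ->
    measurable_fun setT (fun w => ((V w - W w) ^+ 2)%:E).
  by move=> mV; apply/measurable_EFinP; apply: measurable_funX; exact: measurable_funB.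
have sq0 (V : T -> R) w : (0 <= ((V w - W w) ^+ 2)%:E :> \bar R)%E by rewrite lee_fin sqr_ge0.
rewrite unlock (ge0_negligible_integral mA)//; last exact: mq.
rewrite setTD.
pose u (n : nat) (w : T) : \bar R := ((Y (n + N)%N w - W w) ^+ 2)%:E.
rewrite (@eq_integral _ _ _ _ _ (fun w => limn_einf (u ^~ w))); last first.
  move=> w /set_mem nAw.
  have Yw : Y ^~ w @ \oo --> Z w by apply: contrapT => /YZ.
  apply/esym; apply: (cvg_limn_einf_sup _).1; apply/cvg_EFin; first exact: nearW.
  have YwN : Y (n + N)%N w @[n --> \oo] --> Z w by rewrite (cvg_shiftn N (Y ^~ w)).
  by apply: cvgM; (apply: cvgB; [exact: YwN|exact: cvg_cst]).
have mAC : measurable (~` A) by exact: measurableC.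
apply: le_trans (fatou P mAC _ _) _ => //.
  by move=> n; apply: measurable_funTS; exact: mq.
  by move=> n w _; exact: sq0.
(* The lower limit is the limit of the tail infima, and each of these is at most the first term of
   its tail. *)
rewrite limn_einf_lim; apply: lime_le; first exact: is_cvg_einfs.
apply: nearW => n; apply: le_trans (ereal_inf_lbound _) _.
  by exists n => /=.
have := Ye (n + N)%N (leq_addl _ _); rewrite unlock; apply: le_trans.
by apply: ge0_subset_integral => //; [exact: (mq (Y (n + N)%N))|move=> w _; exact: sq0].
Qed.

End mean_square_completeness.

(** * The isometry *)

Section signed_tensor.
Context {R : realType} {X : pointedType} {M : set (set X)}.
Local Notation T1 := (g_sigma_algebraType M).
Local Notation XX := (g_sigma_algebraType (rectangles M)).
Hypotheses (MT : M setT) (MI : setI_closed M).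
Context {m : {charge set XX -> \bar R}} {Pos Neg : set XX}.
Variable hm : hahn_decomposition m Pos Neg.
Variable phi : X -> R.
Hypotheses (mphi : measurable_fun [set: T1] phi) (phi1 : forall x, 1 <= phi x).
Hypothesis iphi :
  (charge_variation hm).-integrable setT (EFin \o tensor phi phi).
Implicit Types u v : X -> R.

Local Notation dominated := (@dominated R X M phi).
Local Notation J u v := (signed_int hm (tensor u v)).
Local Notation "'N[ u , v ]" := (tensor_norm (charge_variation hm) u v)
  (format "''N[' u ,  v ]").

Lemma signed_tensorDl u u' v : dominated u -> dominated u' -> dominated v ->
  J (fun x => u x + u' x) v = J u v + J u' v.
Proof.
move=> du du' dv; rewrite -signed_intD; try exact: (integrable_tensor MT iphi).
by congr signed_int; apply/funext => z; rewrite /tensor mulrDl.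
Qed.

Lemma signed_tensorDr u v v' : dominated u -> dominated v -> dominated v' ->
  J u (fun x => v x + v' x) = J u v + J u v'.
Proof.
move=> du dv dv'; rewrite -signed_intD; try exact: (integrable_tensor MT iphi).
by congr signed_int; apply/funext => z; rewrite /tensor mulrDr.
Qed.

Lemma signed_tensorZl c u v : dominated u -> dominated v ->
  J (fun x => c * u x) v = c * J u v.
Proof.
move=> du dv; rewrite -signed_intZ; try exact: (integrable_tensor MT iphi).
by congr signed_int; apply/funext => z; rewrite /tensor mulrA.
Qed.

Lemma signed_tensorZr c u v : dominated u -> dominated v ->
  J u (fun x => c * v x) = c * J u v.
Proof.
move=> du dv; rewrite -signed_intZ; try exact: (integrable_tensor MT iphi).
by congr signed_int; apply/funext => z; rewrite /tensor mulrCA.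
Qed.

Lemma signed_tensorN u : J (fun x => - u x) (fun x => - u x) = J u u.
Proof.
by congr signed_int; apply/funext => z; rewrite /tensor mulrNN.
Qed.

Lemma le_norm_signed_tensor u v : dominated u -> dominated v ->
  `|J u v| <= 'N[u, v].
Proof.
by move=> du dv; apply: le_norm_signed_int; exact: (integrable_tensor MT iphi).
Qed.

Lemma signed_tensorB_sqr u v : dominated u -> dominated v ->
  J (fun x => u x - v x) (fun x => u x - v x) = J u u - J u v - J v u + J v v.
Proof.
move=> du dv; have dNv := dominatedZ (-1) dv.
have -> : (fun x => u x - v x) = fun x => u x + (-1) * v x.
  by apply/funext => x; rewrite mulN1r.
rewrite !(signed_tensorDl, signed_tensorDr, signed_tensorZl, signed_tensorZr)//;
  try exact: dominatedD.
ring.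
Qed.

(* The parallelogram identity replaces the Cauchy-Schwarz inequality, which fails
   for the integral against |m|. *)
Lemma parallelogram u v : dominated u -> dominated v ->
  J (fun x => u x + v x) (fun x => u x + v x) +
  J (fun x => u x - v x) (fun x => u x - v x) = 2 * J u u + 2 * J v v.
Proof.
move=> du dv; rewrite signed_tensorB_sqr// !(signed_tensorDl, signed_tensorDr)//;
  last exact: dominatedD.
ring.
Qed.

Lemma signed_tensor_indic A B : M A -> M B -> J \1_A \1_B = fine (m (A `*` B)).
Proof.
move=> MA MB; rewrite -(signed_int_indic hm); last exact: measurable_rectangle.
by congr signed_int; apply/funext => z; rewrite /tensor !indicE in_setX -natrM mulnb.
Qed.

Section isometry.
Context {d : measure_display} {Omega : measurableType d}.
Variables (P : probability Omega R) (mu : set X -> Omega -> R).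
Hypothesis mu2 : forall A, M A -> mu A \in Lfun P 2%:E.
Hypothesis mE : forall A B, M A -> M B -> m (A `*` B) = noise_cov P mu A B.

(** The integral of a presentation, not of the function presented. By [expectation_noise_sqr] for
    the difference, two presentations in [M] of one function have almost surely equal integrals. *)
Definition noise_int (l : seq (R * set X)) : Omega -> R :=
  fun w => \sum_(p <- l) p.1 * mu p.2 w.

Lemma noise_int_cat l k w : noise_int (l ++ k) w = noise_int l w + noise_int k w.
Proof. exact: big_cat. Qed.

Lemma noise_int_scale a l w : noise_int (scale_step a l) w = a * noise_int l w.
Proof.
by rewrite /noise_int big_map mulr_sumr; apply: eq_bigr => p _; rewrite mulrA.
Qed.

Lemma noise_int_cons p l : noise_int (p :: l) = (p.1 \o* mu p.2) \+ noise_int l.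
Proof. by apply/funext => w; rewrite /noise_int big_cons/= mulrC. Qed.

Lemma Lfun2_noise_int l : supported M l -> noise_int l \in Lfun P 2%:E.
Proof.
have [L0 LD] := Lfun_addr_closed P (lee1n 2 : (1 <= 2%:E :> \bar R)%E).
elim: l => [_|p l IH /supported_cons[Mp Ml]].
  by rewrite (_ : noise_int _ = 0)//; apply/funext => w; rewrite /noise_int big_nil.
rewrite noise_int_cons; apply: LD; last exact: IH.
by apply: Lfun_scale; [rewrite ler1n|exact: mu2].
Qed.

(** Both sides are bilinear, and on a pair of sets of [M] they agree by [mE]. The induction runs
    over [k] for a single set on the left, then over [l]. *)
Lemma expectation_noise_mul l k : supported M l -> supported M k ->
  'E_P[(noise_int l \* noise_int k)%R]%E = (J (step l) (step k))%:E.
Proof.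
have ds j : supported M j -> dominated (step j) by exact: dominated_step.
have dind A : M A -> dominated \1_A.
  by move=> MA; apply: (dominated_indic phi1); exact: sub_sigma_algebra.
(* The inductive step in the right factor; it serves the left factor too after commuting the
   product. *)
have bilin (a b b' : R) (V W W' : Omega -> R) : V \in Lfun P 2%:E ->
    W \in Lfun P 2%:E -> W' \in Lfun P 2%:E ->
    'E_P[(V \* W)%R]%E = b%:E -> 'E_P[(V \* W')%R]%E = b'%:E ->
    'E_P[(V \* ((a \o* W) \+ W'))%R]%E = (a * b + b')%:E.
  move=> V2 W2 W'2 Eb Eb'.
  have -> : V \* ((a \o* W) \+ W') = (a \o* (V \* W)) \+ (V \* W').
    by apply/funext => w /=; rewrite mulrDr mulrA.
  rewrite expectationD ?expectationZl ?Eb ?Eb'//; try exact: Lfun2_mul_Lfun1.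
  by apply: Lfun_scale => //; exact: Lfun2_mul_Lfun1.
have one A k' : M A -> supported M k' ->
    'E_P[(mu A \* noise_int k')%R]%E = (J \1_A (step k'))%:E.
  move=> MA; elim: k' => [_|q k' IH /supported_cons[Mq Mk']].
    rewrite (_ : mu A \* noise_int [::] = cst 0); last first.
      by apply/funext => w; rewrite /noise_int/= big_nil mulr0.
    rewrite expectation_cst (_ : tensor _ _ = fun=> 0) ?signed_int0//.
    by apply/funext => w; rewrite /tensor /step big_nil mulr0.
  rewrite noise_int_cons step_cons signed_tensorDr ?signed_tensorZr//; try by
    [exact: dind|exact: ds|apply: dominatedZ; exact: dind].
  apply: bilin; [exact: mu2|exact: mu2|exact: Lfun2_noise_int| |exact: IH].
  (* [fine] loses nothing here: a product of two square integrable variables has finite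
     expectation. *)
  rewrite signed_tensor_indic// mE// /noise_cov fineK//.
  by apply: expectation_fin_num; apply: Lfun2_mul_Lfun1; exact: mu2.
move=> Ml Mk; elim: l Ml => [_|p l IH /supported_cons[Mp Ml]].
  rewrite (_ : noise_int [::] \* _ = cst 0); last first.
    by apply/funext => w; rewrite /noise_int/= big_nil mul0r.
  rewrite expectation_cst (_ : tensor _ _ = fun=> 0) ?signed_int0//.
  by apply/funext => w; rewrite /tensor /step big_nil mul0r.
have mulC (V W : Omega -> R) : V \* W = W \* V by apply/funext => w /=; rewrite mulrC.
rewrite noise_int_cons step_cons signed_tensorDl ?signed_tensorZl//; try by
  [exact: dind|exact: ds|apply: dominatedZ; exact: dind].
rewrite mulC; apply: bilin; [exact: Lfun2_noise_int|exact: mu2|exact: Lfun2_noise_int| |].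
  by rewrite mulC one.
by rewrite mulC IH.
Qed.

Lemma expectation_noise_sqr l : supported M l ->
  'E_P[(fun w => noise_int l w ^+ 2)%R]%E = (J (step l) (step l))%:E.
Proof. by move=> Ml; rewrite -expectation_noise_mul. Qed.

Lemma signed_tensor_step_ge0 l : supported M l -> 0 <= J (step l) (step l).
Proof.
move=> Ml; rewrite -lee_fin -expectation_noise_sqr//.
by apply: expectation_ge0 => w; exact: sqr_ge0.
Qed.

Hypothesis nuC : forall E : set XX, measurable E ->
  charge_variation hm (swap_pair @^-1` E) = charge_variation hm E.

(** The form is nonnegative at a close step function [u - v]. Expanding there, the terms that
    contain [v] are as small as desired, so the value at [u] is at least [- e] for every positive
    [e]. *)
Lemma signed_tensor_ge0 u : dominated u -> 0 <= J u u.
Proof.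
move=> du; have [mu_ [K uK]] := du.
have dphi : dominated phi by exact: dominated_phi.
have phi0 x : 0 <= phi x by exact: le_trans (phi1 x).
have K0 : 0 <= K.
  have := le_trans (normr_ge0 _) (uK point).
  by rewrite pmulr_lge0// (lt_le_trans ltr01).
apply/ler_addgt0Pr => e e0.
have D0 : 0 < 3 + 4 * K by rewrite ltr_pwDl// mulr_ge0.
have [l [Ml vv vphi]] := step_density MT MI mphi phi1 iphi nuC du (divr_gt0 e0 D0).
set v := (fun x => u x - step l x) in vv vphi.
have dl : dominated (step l) by exact: (dominated_step phi1).
have dv : dominated v by exact: dominatedB.
have E : step l = fun x => u x - v x.
  by apply/funext => x; rewrite /v opprB addrC subrK.
have uv : 'N[v, u] <= K * 'N[v, phi].
  rewrite !(tensor_normC MT nuC dv)// -[K]ger0_norm// -(tensor_normZl MT iphi)//.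
  apply: (le_tensor_norm MT iphi) => //; first exact: dominatedZ.
  by move=> x; rewrite normrM (ger0_norm K0) (ger0_norm (phi0 x)).
(* Half the sum of the two bounds on [r] gives [2 * k * n + n1 <= r], which absorbs the cross terms
   [a], [b] and the square [c]. *)
have arith (k r a b c z n n1 n2 : R) : 0 <= k -> 0 <= n -> 0 <= n1 ->
    n2 <= k * n -> n * (3 + 4 * k) < r -> n1 * (3 + 4 * k) < r ->
    `|a| <= n2 -> `|b| <= n2 -> `|c| <= n1 -> 0 <= z - a - b + c -> 0 <= z + r.
  rewrite !ler_norml => k0 n0 n10 n2k nr n1r /andP[a1 a2] /andP[b1 b2] /andP[c1 c2] h.
  have : 0 <= k * n by rewrite mulr_ge0.
  have : 0 <= k * n1 by rewrite mulr_ge0.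
  lra.
rewrite ltr_pdivlMr// in vv; rewrite ltr_pdivlMr// in vphi.
apply: (arith K e (J u v) (J v u) (J v v) (J u u) 'N[v, phi] 'N[v, v] 'N[v, u]) => //.
- exact: tensor_norm_ge0.
- exact: tensor_norm_ge0.
- by rewrite -(tensor_normC MT nuC du dv); exact: le_norm_signed_tensor.
- exact: le_norm_signed_tensor.
- exact: le_norm_signed_tensor.
by rewrite -signed_tensorB_sqr// -E; exact: signed_tensor_step_ge0.
Qed.

(** The difference is the integral of a presentation of [(step l - f) - (step k - f)]. Apply the
    parallelogram identity and drop the term of the sum, which is nonnegative. *)
Lemma expectation_noise_sub l k (f : X -> R) : dominated f ->
  supported M l -> supported M k ->
  ('E_P[(fun w => (noise_int l w - noise_int k w) ^+ 2)%R] <=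
   (2 * J (fun x => step l x - f x) (fun x => step l x - f x) +
    2 * J (fun x => step k x - f x) (fun x => step k x - f x))%:E)%E.
Proof.
move=> df Ml Mk; pose lk := l ++ scale_step (-1) k.
have Mlk : supported M lk by apply: supported_cat => //; exact: supported_scale.
rewrite (_ : (fun w => _) = (fun w => noise_int lk w ^+ 2)); last first.
  by apply/funext => w; rewrite /lk noise_int_cat noise_int_scale mulN1r.
have dl := dominated_step phi1 Ml; have dk := dominated_step phi1 Mk.
rewrite expectation_noise_sqr// lee_fin -parallelogram//; try exact: dominatedB.
rewrite (_ : step lk = fun x => (step l x - f x) - (step k x - f x)).
  by rewrite lerDr; apply: signed_tensor_ge0; apply: dominatedD; exact: dominatedB.
by apply/funext => x; rewrite /lk step_cat step_scale mulN1r opprB addrA subrK.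
Qed.

End isometry.
End signed_tensor.

(** * The stochastic integral *)

Lemma Lfun2_sqr_lty {d : measure_display} {T : measurableType d} {R : realType}
    (P : probability T R) (g : T -> R) : measurable_fun setT g ->
  ('E_P[(fun w => g w ^+ 2)%R] < +oo)%E -> g \in Lfun P 2%:E.
Proof.
move=> mg goo; rewrite inE; apply/andP; split; rewrite inE//=.
rewrite /finite_norm unlock poweR_lty//.
move: goo; rewrite unlock; apply: le_lt_trans.
by under eq_integral do rewrite /= powR_mulrn// real_normK ?num_real//.
Qed.

Lemma step_fun_of_seq {R : realType} {X : Type} (M : set (set X))
    (l : seq (R * set X)) n : M setT -> supported M l -> (size l <= n)%N ->
  exists c A, (forall k, (1 <= k <= n)%N -> M (A k)) /\ step_fun n c A = step l.
Proof.
(* [step_fun] counts from 1, hence [k.-1]. The default [(0, setT)] pads with null terms whose set is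
   still in [M]. *)
move=> MT Ml ln; pose p k := nth (0, setT) l k.-1.
exists (fun k => (p k).1), (fun k => (p k).2); split.
  move=> k _; rewrite /p; have [kl|lk] := ltnP k.-1 (size l).
    exact/Ml/mem_nth.
  by rewrite nth_default.
apply/funext => x; rewrite /step_fun /step big_add1/= (big_nth (0, setT)).
rewrite (@big_cat_nat _ _ _ (size l))//= [X in _ + X]big_nat_cond.
rewrite [X in _ + X]big1 ?addr0//.
by move=> k; rewrite andbT => /andP[lk _]; rewrite /p/= nth_default// mul0r.
Qed.

Section seq_of_step_fun.
Context {R : realType} {X Omega : Type}.
Variables (K : nat) (c : nat -> R) (A : nat -> set X).

Definition seq_of_step_fun : seq (R * set X) :=
  [seq (c k, A k) | k <- index_iota 1 K.+1].

Lemma step_seq_of_step_fun : step seq_of_step_fun = step_fun K c A.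
Proof. by apply/funext => x; rewrite /step big_map. Qed.

Lemma noise_int_seq_of_step_fun (mu : set X -> Omega -> R) w :
  \sum_(p <- seq_of_step_fun) p.1 * mu p.2 w = step_integral mu K c A w.
Proof. by rewrite big_map. Qed.

Lemma supported_seq_of_step_fun (M : set (set X)) :
  (forall k, (1 <= k <= K)%N -> M (A k)) -> supported M seq_of_step_fun.
Proof. by move=> MA _ /mapP[k + ->]; rewrite mem_index_iota => /MA. Qed.

End seq_of_step_fun.

(* At stage n, use the term of largest index among the first n + 1 that have size
   at most n. *)
Lemma diagonal_size (R : realType) (T : eqType) (D : seq T -> R)
    (L : nat -> seq T) (b : nat -> R) :
  (forall j, 0 <= D (L j) <= b j) -> nonincreasing_seq b ->
  b @ \oo --> 0 ->
  exists g : nat -> seq T, [/\ forall n, (size (g n) <= n)%N,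
    forall n, g n = [::] \/ exists j, g n = L j & D (g n) @[n --> \oo] --> 0].
Proof.
move=> DL bni b0.
pose idx n : nat := \max_(j < n.+1 | (size (L j) <= n)%N) j.
(* When no index qualifies the maximum is 0 and [L 0] may be too long, hence the test. *)
exists (fun n => if (size (L (idx n)) <= n)%N then L (idx n) else [::]); split.
- by move=> n; case: ifP.
- by move=> n; case: ifP => _; [right; exists (idx n)|left].
apply/cvgr0Pnorm_lt => e e0.
have /cvgr0Pnorm_lt /(_ _ e0) [j _ /(_ j (leqnn j)) /= je] := b0.
near=> n.
have jn : (j < n.+1)%N by rewrite ltnS; near: n; exact: nbhs_infty_ge.
have ln : (size (L j) <= n)%N by near: n; exact: nbhs_infty_ge.
(* For large [n] the index [j] competes, so the maximum is attained at some [i] with [j <= i], where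
   [b i <= b j]. *)
have [i il iE] : {i : 'I_n.+1 | (size (L i) <= n)%N & idx n = i}.
  apply: eq_bigmax_cond; apply/card_gt0P; exists (Ordinal jn).
  by rewrite unfold_in.
have /andP[D0 Db] := DL i.
rewrite iE il ger0_norm//; apply: le_lt_trans Db (le_lt_trans _ (le_lt_trans (ler_norm _) je)).
apply: bni; rewrite -iE; exact: (leq_bigmax_cond (Ordinal jn)).
Unshelve. all: by end_near. Qed.

(** * Approximation and stochastic integral of a fixed integrand *)

Section main.
Context {d : measure_display} {Omega : measurableType d} {R : realType}.
Variables (P : probability Omega R) (X : pointedType) (M : set (set X)).
Variable mu : set X -> Omega -> R.
Variable m : {charge set (g_sigma_algebraType (rectangles M)) -> \bar R}.
Variables (Pos Neg : set (g_sigma_algebraType (rectangles M))) (f : X -> R).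
Hypotheses (MT : M setT) (MI : setI_closed M).
Hypothesis mu2 : forall A, M A -> mu A \in Lfun P 2%:E.
Hypothesis mE : forall A B, M A -> M B -> m (A `*` B) = noise_cov P mu A B.
Variable hm : hahn_decomposition m Pos Neg.
Hypotheses (fS : in_S hm f) (f1 : pair_integrable hm f \1_setT).

Let phi x := 1 + `|f x|.
Let mphi : measurable_fun [set: g_sigma_algebraType M] phi.
Proof. by apply: measurable_funD => //; apply: measurableT_comp => //; exact: fS.1. Qed.

Let phi1 x : 1 <= phi x. Proof. by rewrite lerDl. Qed.

Let nuC (E : set (g_sigma_algebraType (rectangles M))) : measurable E ->
  charge_variation hm (swap_pair @^-1` E) = charge_variation hm E.
Proof.
apply: charge_variation_swap => // A B MA MB; rewrite !mE// /noise_cov.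
by congr expectation; apply/funext => w; rewrite mulrC.
Qed.

(** Expand [(1 + |f t|) * (1 + |f s|)]: the constant is integrable because the variation is finite,
    [|f t|] by [f1], [|f s|] by symmetry, and the product because [f] is in S. *)
Let iphi : (charge_variation hm).-integrable setT (EFin \o tensor phi phi).
Proof.
have [mf iff] := fS.
have if1 : (charge_variation hm).-integrable setT (EFin \o (fun z => `|f z.1|)).
  apply: integrable_norm; apply: eq_integrable f1 => // z _ /=.
  by rewrite indicT mulr1.
have i1f := integrable_swap nuC if1.
have i1 : (charge_variation hm).-integrable setT (EFin \o cst 1).
  apply/integrableP; split; first exact/measurable_EFinP/measurable_cst.
  rewrite /= normr1 integral_cst// mul1e ltey_eq.
  by rewrite /charge_variation fin_numD !fin_num_measure.
have := integrableD measurableT (integrableD measurableT i1 if1)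
  (integrableD measurableT i1f (integrable_norm iff)).
apply: eq_integrable => // z _ /=; rewrite -!EFinD; congr EFin.
by rewrite /tensor /phi normrM /=; ring.
Qed.

Let df : dominated (M := M) phi f.
Proof. by split; [exact: fS.1|exists 1 => x; rewrite mul1r lerDr]. Qed.

Let dist2 (l : seq (R * set X)) : R :=
  signed_int hm (tensor (fun x => step l x - f x) (fun x => step l x - f x)).

Let dist2_ge0 l : supported M l -> 0 <= dist2 l.
Proof.
move=> Ml; apply: (signed_tensor_ge0 MT MI mphi phi1 iphi mu2 mE nuC).
by apply: dominatedB => //; exact: dominated_step.
Qed.

(** Positivity of [dist2] matters: [Num.sqrt] sends negative numbers to 0. *)
Let norm_S_step l : supported M l ->
  dist2 l = norm_S hm (fun x => step l x - f x) ^+ 2.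
Proof. by move=> Ml; rewrite /norm_S sqr_sqrtr//; exact: dist2_ge0. Qed.

Let dist2_lt e : 0 < e -> exists2 l, supported M l & dist2 l < e.
Proof.
move=> e0; have [l [Ml le _]] := step_density MT MI mphi phi1 iphi nuC df e0.
exists l => //; apply: le_lt_trans le.
have dv : dominated (M := M) phi (fun x => f x - step l x).
  by apply: dominatedB => //; exact: dominated_step.
apply: le_trans (le_trans (ler_norm _) (le_norm_signed_tensor MT iphi dv dv)).
rewrite -signed_tensorN (_ : (fun x => - _) = fun x => step l x - f x)//.
by apply/funext => x; rewrite opprB.
Qed.

(** The rate [1 / 4 ^ n] is the one that [ae_cvg_fast] requires. *)
Let approximants : exists L : nat -> seq (R * set X),
  forall n, supported M (L n) /\ dist2 (L n) < 1 / 4 ^+ n.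
Proof.
have /choice[L LP] : forall n, exists l, supported M l /\ dist2 l < 1 / 4 ^+ n.
  move=> n; have [|l Ml lt] := @dist2_lt (1 / 4 ^+ n); last by exists l.
  by rewrite divr_gt0// exprn_gt0.
by exists L.
Qed.

Let geometric_cvg0 : (1 / 4 ^+ n : R) @[n --> \oo] --> 0.
Proof.
under eq_fun do rewrite -exprVn.
by apply: cvg_geometric; rewrite ger0_norm ?invr_ge0// invf_lt1 ?ltr1n.
Qed.

Let dist2_near0 (L : nat -> seq (R * set X)) : (forall n, supported M (L n)) ->
  dist2 (L n) @[n --> \oo] --> 0 ->
  norm_S hm (fun x => step (L n) x - f x) @[n --> \oo] --> 0.
Proof.
move=> ML L0; rewrite -[X in _ --> X](@sqrtr0 R).
by apply: (continuous_cvg _ _ L0); exact: sqrt_continuous.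
Qed.

(** The term of index [n] may have at most [n] summands. [diagonal_size] delays the approximants
    until they fit, and [step_fun_of_seq] pads them to length [n]. *)
Lemma exists_step_cvg :
  exists (c : nat -> nat -> R) (A : nat -> nat -> set X),
    (forall n k, (1 <= k <= n)%N -> M (A n k)) /\
    cvg_S hm (fun n => step_fun n (c n) (A n)) f.
Proof.
have [L LP] := approximants.
have [g [gn gL g0]] : exists g : nat -> seq (R * set X),
    [/\ forall n, (size (g n) <= n)%N,
    forall n, g n = [::] \/ exists j, g n = L j & dist2 (g n) @[n --> \oo] --> 0].
  apply: (diagonal_size (b := fun n => 1 / 4 ^+ n)) => [j|i j ij|//].
    by have [Lj /ltW ->] := LP j; rewrite dist2_ge0.
  by rewrite !div1r lef_pV2 ?posrE ?exprn_gt0// ler_weXn2l ?ler1n.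
have Mg n : supported M (g n).
  by have [->|[j ->]] := gL n => //; exact: (LP j).1.
have /choice[c /choice[A cA]] : forall n, exists c A,
    (forall k, (1 <= k <= n)%N -> M (A k)) /\ step_fun n c A = step (g n).
  by move=> n; exact: step_fun_of_seq.
exists c, A; split; first by move=> n; exact: (cA n).1.
rewrite /cvg_S; under eq_fun do rewrite (cA _).2.
exact: dist2_near0.
Qed.

(** [eta] is the almost sure limit along one fixed fast sequence. As [eta_dist] holds for every step
    function, any approximating sequence is squeezed to this same [eta]. *)
Lemma exists_stochastic_integral :
  exists eta : Omega -> R, eta \in Lfun P 2%:E /\
  forall (K : nat -> nat) (c : nat -> nat -> R) (A : nat -> nat -> set X),
    (forall n k, (1 <= k <= K n)%N -> M (A n k)) ->
    cvg_S hm (fun n => step_fun (K n) (c n) (A n)) f ->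
    mean_square_cvg P (fun n => step_integral mu (K n) (c n) (A n)) eta.
Proof.
have [L LP] := approximants.
pose Y n := noise_int mu (L n).
have Lfun_noise l : supported M l -> noise_int mu l \in Lfun P 2%:E.
  exact: Lfun2_noise_int.
have mnoise l : supported M l -> measurable_fun setT (noise_int mu l).
  by move=> /Lfun_noise /sub_Lfun_mfun; rewrite inE.
have dist l k : supported M l -> supported M k ->
    ('E_P[(fun w => (noise_int mu l w - noise_int mu k w) ^+ 2)%R] <=
     (2 * dist2 l + 2 * dist2 k)%:E)%E.
  exact: (expectation_noise_sub MT MI mphi phi1 iphi mu2 mE nuC df).
have ML n : supported M (L n) := (LP n).1.
(* The constant 4 comes from [2 / 4 ^ n.+1 + 2 / 4 ^ n <= 4 / 4 ^ n]. *)
have [||n|eta meta Yeta] := @ae_cvg_fast _ _ _ P Y 4.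
- by [].
- by move=> n; exact: mnoise.
- apply: le_trans (dist _ _ (ML _) (ML _)) _; rewrite lee_fin.
  have := (LP n).2; have := (LP n.+1).2.
  have : 1 / 4 ^+ n.+1 <= 1 / 4 ^+ n :> R.
    by rewrite !div1r lef_pV2 ?posrE ?exprn_gt0// ler_weXn2l ?ler1n.
  by rewrite [4 / _]mulrC -[_ ^-1]mul1r; lra.
(* Far along the sequence the term [2 * dist2 (L n)] is below [e], so Fatou's lemma leaves only the
   contribution of [l]. *)
have eta_dist l : supported M l ->
    ('E_P[(fun w => (eta w - noise_int mu l w) ^+ 2)%R] <= (2 * dist2 l)%:E)%E.
  move=> Ml; apply/lee_addgt0Pr => e e0; rewrite -EFinD.
  have e20 : 0 < e / 2 by rewrite divr_gt0.
  have /cvgr0Pnorm_lt /(_ _ e20) [N _ hN] := geometric_cvg0.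
  apply: (fatou_mean_square (N := N) _ meta (mnoise _ Ml) Yeta).
    by move=> n; exact: mnoise.
  move=> n Nn; apply: le_trans (dist _ _ (ML n) Ml) _; rewrite lee_fin.
  have := le_lt_trans (ler_norm _) (hN n Nn); have := (LP n).2; lra.
exists eta; split.
  have [_ LD] := Lfun_addr_closed P (lee1n 2 : (1 <= 2%:E :> \bar R)%E).
  (* The difference with [Y 0] has a finite second moment by [eta_dist], and [Y 0] is square
     integrable. *)
  rewrite (_ : eta = (fun w => eta w - Y 0%N w) + Y 0%N); last first.
    by apply/funext => w /=; rewrite [RHS]subrK.
  apply: LD; last exact: Lfun_noise.
  apply: Lfun2_sqr_lty; first by apply: measurable_funB => //; exact: mnoise.
  exact: le_lt_trans (eta_dist _ (ML 0%N)) (ltry _).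
move=> K c A MA FS.
pose l n := seq_of_step_fun (K n) (c n) (A n).
have Ml n : supported M (l n) by apply: supported_seq_of_step_fun; exact: MA.
have l0 : (2 * dist2 (l n))%:E @[n --> \oo] --> 0%E.
  apply/cvg_EFin; first exact: nearW.
  rewrite -(mulr0 2); apply: cvgM; first exact: cvg_cst.
  rewrite /= (_ : (fun n => _) = fun n =>
    norm_S hm (fun x => step_fun (K n) (c n) (A n) x - f x) ^+ 2).
    by rewrite -[X in _ --> X](mulr0 (0 : R)); apply: cvgM; exact: FS.
  by apply/funext => n; rewrite norm_S_step// step_seq_of_step_fun.
apply: (squeeze_cvge _ (cvg_cst 0%E) l0); apply: nearW => n.
rewrite expectation_ge0 => [|w]; last exact: sqr_ge0.
rewrite (_ : (fun w => _) = fun w => (eta w - noise_int mu (l n) w) ^+ 2).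
  exact: eta_dist.
by apply/funext => w; rewrite -noise_int_seq_of_step_fun -sqrrN opprB.
Qed.

End main.

Theorem theorem1
    (d : measure_display) (Omega : measurableType d) (R : realType)
    (P : probability Omega R) (X : pointedType) (M : set (set X))
    (mu : set X -> Omega -> R)
    (m : {charge set (g_sigma_algebraType (rectangles M)) -> \bar R})
    (Pos Neg : set (g_sigma_algebraType (rectangles M)))
    (f : X -> R)
    (hM : semiring_with_identity M)
    (hmu : noise P M mu)
    (hcov : cov_sigma_additive P M mu)
    (hmE : forall A B, M A -> M B -> m (A `*` B) = noise_cov P mu A B)
    (hm : hahn_decomposition m Pos Neg)
    (hf : in_S hm f)
    (hdf : forall A, M A -> pair_integrable hm f \1_A) :
  (exists (c : nat -> nat -> R) (A : nat -> nat -> set X),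
     (forall n k, (1 <= k <= n)%N -> M (A n k)) /\
     cvg_S hm (fun n => step_fun n (c n) (A n)) f)
  /\
  (exists eta : Omega -> R,
     eta \in Lfun P 2%:E /\
     forall (K : nat -> nat) (c : nat -> nat -> R) (A : nat -> nat -> set X),
       (forall n k, (1 <= k <= K n)%N -> M (A n k)) ->
       cvg_S hm (fun n => step_fun (K n) (c n) (A n)) f ->
       mean_square_cvg P (fun n => step_integral mu (K n) (c n) (A n)) eta).
Proof.
have [MT MI _] := hM; have [mu2 _] := hmu.
split; first exact: (exists_step_cvg MT MI mu2 hmE hf (hdf _ MT)).
exact: (exists_stochastic_integral MT MI mu2 hmE hf (hdf _ MT)).
Qed.
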